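(* Let $G$ be a connected graph of order $n$ and size $m$ with maximum degree $\Delta$ and minimum degree $\delta$. Then $$BSO(G)\leq \frac{H(G)\,SDD(G)+2M_2^{*}(G)\,ISI(G)}{\sqrt{2}\,GA(G)},$$ with equality if and only if $G$ is a regular graph.
   Context: Graphs are finite, simple and undirected; order and size are the numbers of vertices and edges. For a connected graph $G$ with edge set $E(G)$, $d_v$ denotes the degree of the vertex $v$ in $G$. The first Banhatti-Sombor index is $BSO(G)=\sum_{uv\in E(G)}\sqrt{\frac{1}{d_u^2}+\frac{1}{d_v^2}}$, the harmonic index is $H(G)=\sum_{uv\in E(G)}\frac{2}{d_u+d_v}$, the symmetric division deg index is $SDD(G)=\sum_{uv\in E(G)}\frac{d_u^2+d_v^2}{2d_ud_v}$, the modified second Zagreb index is $M_2^{*}(G)=\sum_{uv\in E(G)}\frac{1}{d_ud_v}$, the inverse sum indeg index is $ISI(G)=\sum_{uv\in E(G)}\frac{d_ud_v}{d_u+d_v}$, and the geometric-arithmetic index is $GA(G)=\sum_{uv\in E(G)}\frac{2\sqrt{d_ud_v}}{d_u+d_v}$. *)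

(* Defs.v *)
From mathcomp Require Import all_boot all_order all_algebra.
Set Implicit Arguments.
Unset Strict Implicit.
Unset Printing Implicit Defensive.
Import Order.TTheory GRing.Theory Num.Theory.
Local Open Scope ring_scope.

Record sgraph := SGraph {
  vertex :> finType;
  adj : rel vertex;
  adj_sym : symmetric adj;
  adj_irr : irreflexive adj
}.

Section Graph.
Variable G : sgraph.
Implicit Types u v : G.

Definition degree v : nat := #|[set u | adj v u]|.

(* An edge {u, v} is represented by the one of its two orientations (u, v),  *)
(* (v, u) that is increasing for the enumeration of the vertices; each edge  *)
(* occurs exactly once, and since every summand below is symmetric in u and  *)
(* v, the sums do not depend on the chosen orientation.                      *)
Definition edges : {set G * G} :=
  [set p | adj p.1 p.2 & (enum_rank p.1 < enum_rank p.2)%N].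

Definition graph_order : nat := #|G|.
Definition graph_size : nat := #|edges|.

Definition connected : Prop :=
  (0 < #|G|)%N /\ forall u v, connect (@adj G) u v.

Definition regular : Prop := exists k : nat, forall v, degree v = k.

Definition max_degree : nat := \max_(v : G) degree v.

(* Every degree is less than #|G|, so the default value #|G| has no effect   *)
(* on the minimum when G has a vertex.                                       *)
Definition min_degree : nat := \big[minn/#|G|]_(v : G) degree v.

Variable R : rcfType.

Local Notation d v := ((degree v)%:R : R).

Definition BSO : R :=
  \sum_(e in edges) Num.sqrt (1 / d e.1 ^+ 2 + 1 / d e.2 ^+ 2).

Definition harmonic : R := \sum_(e in edges) 2 / (d e.1 + d e.2).

Definition SDD : R :=
  \sum_(e in edges) (d e.1 ^+ 2 + d e.2 ^+ 2) / (2 * d e.1 * d e.2).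

Definition M2star : R := \sum_(e in edges) 1 / (d e.1 * d e.2).

Definition ISI : R := \sum_(e in edges) (d e.1 * d e.2) / (d e.1 + d e.2).

Definition GA : R :=
  \sum_(e in edges) 2 * Num.sqrt (d e.1 * d e.2) / (d e.1 + d e.2).

End Graph.

(* Main.v *)
Require Import Defs.
From mathcomp Require Import all_boot all_order all_algebra.
From mathcomp Require Import ring.
Import Order.TTheory GRing.Theory Num.Theory.
Local Open Scope ring_scope.

(** When G has an edge, [Num.sqrt 2 * GA G R] is positive; after multiplication
    by it, the claimed inequality compares products of sums over edges, so it can be read
    as a comparison of double sums over pairs of edges (e, f).  If e has end
    degrees a, b and f has end degrees c, d, the pair contributes
      2/(a+b) * (c^2+d^2)/(2cd) + 2 * 1/(cd) * ab/(a+b)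
    to the numerator on the right; e carries the harmonic and ISI summands, f
    carries those of SDD and M2star.  By AM-GM this is at least
      sqrt 2 * (2 sqrt(ab)/(a+b)) * sqrt(1/c^2 + 1/d^2),
    the contribution to [Num.sqrt 2 * BSO G R * GA G R], because
    the difference of the two is exactly a square divided by a positive number:
      (sqrt(c^2+d^2) - sqrt(2ab))^2 / ((a+b)cd)
    ([edge_pair_defect], summed up in [bound_defect]).

    Equality thus means c^2 + d^2 = 2ab for all pairs of edges.  The diagonal
    pair e = f already gives (a-b)^2 = 0, so adjacent vertices have the same
    degree, and by connectedness the graph is regular.  Conversely, all the
    squares vanish on a regular graph.  A graph without edges has GA = 0, but
    then both sides are 0 and, if connected, it is a single vertex, hence
    regular. *)

Lemma sqrt_sum_inv_sqr (R : rcfType) (c d : R) : 0 < c -> 0 < d ->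
  Num.sqrt (1 / c ^+ 2 + 1 / d ^+ 2) = Num.sqrt (c ^+ 2 + d ^+ 2) / (c * d).
Proof.
move=> c0 d0; have cd0 : 0 < c * d by rewrite mulr_gt0.
have -> : 1 / c ^+ 2 + 1 / d ^+ 2 = (c ^+ 2 + d ^+ 2) * (c * d)^-1 ^+ 2.
  by field; rewrite !gt_eqF.
by rewrite sqrtrM ?addr_ge0 ?sqr_ge0 // sqrtr_sqr ger0_norm // invr_ge0 ltW.
Qed.

(** The AM-GM gap of a pair of edges.  Taking both square roots out as
    variables whose squares are known turns the identity into one between
    rational functions. *)
Lemma edge_pair_defect (R : rcfType) (a b c d : R) :
  0 < a -> 0 < b -> 0 < c -> 0 < d ->
  2 / (a + b) * ((c ^+ 2 + d ^+ 2) / (2 * c * d))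
    + 2 * (1 / (c * d)) * (a * b / (a + b))
    - Num.sqrt 2 * Num.sqrt (1 / c ^+ 2 + 1 / d ^+ 2)
      * (2 * Num.sqrt (a * b) / (a + b))
  = (Num.sqrt (c ^+ 2 + d ^+ 2) - Num.sqrt (2 * (a * b))) ^+ 2
    / ((a + b) * (c * d)).
Proof.
move=> a0 b0 c0 d0; rewrite sqrt_sum_inv_sqr // [Num.sqrt (2 * _)]sqrtrM //.
have ab0 : a + b != 0 by rewrite gt_eqF ?addr_gt0.
rewrite sqrrB exprMn !sqr_sqrtr ?addr_ge0 ?sqr_ge0 ?mulr_ge0 ?ltW //.
by field; rewrite ab0 !gt_eqF.
Qed.

Section Graph.
Variables (R : rcfType) (G : sgraph).
Local Notation d v := ((degree v)%:R : R).
Local Notation bound_num := (harmonic G R * SDD G R + 2 * M2star G R * ISI G R).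

Definition edge_pair_gap (e f : G * G) : R :=
  (Num.sqrt (d f.1 ^+ 2 + d f.2 ^+ 2) - Num.sqrt (2 * (d e.1 * d e.2))) ^+ 2
  / ((d e.1 + d e.2) * (d f.1 * d f.2)).

Lemma degree_gt0 (u v : G) : adj u v -> 0 < d u.
Proof. by move=> uv; rewrite ltr0n; apply/card_gt0P; exists v; rewrite inE. Qed.

Lemma edge_degree_gt0 (e : G * G) : e \in edges G -> 0 < d e.1 /\ 0 < d e.2.
Proof.
rewrite inE => /andP[uv _]; split; first exact: degree_gt0 uv.
by apply: (@degree_gt0 _ e.1); rewrite adj_sym.
Qed.

Lemma edge_pair_gap_ge0 (e f : G * G) : 0 <= edge_pair_gap e f.
Proof. by rewrite divr_ge0 ?sqr_ge0 // mulr_ge0 ?addr_ge0 ?mulr_ge0. Qed.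

Lemma edge_pair_gap_eq0 (e f : G * G) : e \in edges G -> f \in edges G ->
  (edge_pair_gap e f == 0)
  = (d f.1 ^+ 2 + d f.2 ^+ 2 == 2 * (d e.1 * d e.2)).
Proof.
move=> /edge_degree_gt0[a0 b0] /edge_degree_gt0[c0 d0].
have den_neq0 : (d e.1 + d e.2) * (d f.1 * d f.2) != 0.
  by rewrite gt_eqF // mulr_gt0 ?addr_gt0 ?mulr_gt0.
rewrite mulf_eq0 invr_eq0 (negPf den_neq0) orbF.
rewrite sqrf_eq0 subr_eq0 -(eqrXn2 (n := 2)) ?sqrtr_ge0 //.
by rewrite !sqr_sqrtr ?addr_ge0 ?sqr_ge0 ?mulr_ge0 ?ltW.
Qed.

Lemma bound_defect :
  bound_num - BSO G R * (Num.sqrt 2 * GA G R)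
  = \sum_(f in edges G) \sum_(e in edges G) edge_pair_gap e f.
Proof.
rewrite [BSO G R * _]mulrCA mulrA [harmonic G R * _]mulrC.
rewrite /SDD /M2star /BSO [2 * _]mulr_sumr [Num.sqrt 2 * _]mulr_sumr.
rewrite !mulr_suml -big_split -sumrB.
apply: eq_bigr => f /edge_degree_gt0[c0 d0].
rewrite /harmonic /ISI /GA !mulr_sumr -big_split -sumrB.
apply: eq_bigr => e /edge_degree_gt0[a0 b0].
by rewrite /edge_pair_gap -edge_pair_defect //= [X in X + _ - _]mulrC.
Qed.

Lemma GA_gt0 (e : G * G) : e \in edges G -> 0 < GA G R.
Proof.
move=> eE; rewrite /GA (bigD1 e) //= ltr_pwDl //.
  have [a0 b0] := edge_degree_gt0 _ eE.
  by rewrite divr_gt0 ?addr_gt0 // mulr_gt0 // sqrtr_gt0 mulr_gt0.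
by apply: sumr_ge0 => f _; rewrite divr_ge0 ?addr_ge0 ?mulr_ge0 ?sqrtr_ge0.
Qed.

Lemma adj_edge (u v : G) : adj u v -> (u, v) \in edges G \/ (v, u) \in edges G.
Proof.
move=> uv; rewrite !inE /= [adj v u]adj_sym uv /=.
case: ltngtP => [||/val_inj/enum_rank_inj euv]; [by left|by right|].
by rewrite euv adj_irr in uv.
Qed.

Lemma regular_of_edges : connected G ->
  {in edges G, forall e, degree e.1 = degree e.2} -> regular G.
Proof.
case=> /card_gt0P[x _] conn eqd; exists (degree x) => v.
have /connectP[p + ->] := conn x v.
elim: p x {conn} => [|y p IH] x //= /andP[xy /IH ->].
by case: (adj_edge _ _ xy) => /eqd.
Qed.

Lemma gap_sum_eq0 : connected G ->
  \sum_(f in edges G) \sum_(e in edges G) edge_pair_gap e f = 0 <-> regular G.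
Proof.
move=> conn; split=> [sum0|[k regk]]; last first.
  apply: big1 => f fE; apply: big1 => e eE; apply/eqP.
  by rewrite edge_pair_gap_eq0 // !regk -mulr2n mulr_natl.
apply: regular_of_edges => // e eE.
have inner_ge0 f : f \in edges G -> 0 <= \sum_(e in edges G) edge_pair_gap e f.
  by move=> _; apply: sumr_ge0 => ? _; exact: edge_pair_gap_ge0.
have sum0e := psumr_eq0P inner_ge0 sum0 eE.
(* the pair formed by an edge and itself gives (d e.1 - d e.2)^2 = 0 *)
have /eqP := psumr_eq0P (fun f _ => edge_pair_gap_ge0 f e) sum0e eE.
rewrite edge_pair_gap_eq0 // => /eqP eq2; apply/eqP; rewrite -(eqr_nat R).
by rewrite -subr_eq0 -sqrf_eq0 sqrrB addrAC eq2 mulr_natl subrr.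
Qed.

End Graph.

Theorem theorem3p18 (R : rcfType) (G : sgraph) (n m Delta delta : nat)
  (hconn : connected G)
  (hn : graph_order G = n) (hm : graph_size G = m)
  (hDelta : max_degree G = Delta) (hdelta : min_degree G = delta) :
  BSO G R <= (harmonic G R * SDD G R + 2 * M2star G R * ISI G R)
               / (Num.sqrt 2 * GA G R)
  /\ (BSO G R = (harmonic G R * SDD G R + 2 * M2star G R * ISI G R)
                  / (Num.sqrt 2 * GA G R)
      <-> regular G).
Proof.
rewrite -(gap_sum_eq0 R G hconn).
have [E0|[e eE]] := set_0Vmem (edges G).
  (* all sums are empty, and the quotient 0 / 0 is 0 *)
  rewrite /BSO /harmonic /M2star E0 !big_set0 mulr0 !mul0r addr0 mul0r.
  by split.
have den_gt0 : 0 < Num.sqrt 2 * GA G R.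
  by rewrite mulr_gt0 ?sqrtr_gt0 ?ltr0n // (GA_gt0 R G e).
rewrite -bound_defect ler_pdivlMr // -subr_ge0; split.
  rewrite bound_defect; apply: sumr_ge0 => f _; apply: sumr_ge0 => e' _.
  exact: edge_pair_gap_ge0.
split=> [->|/eqP]; first by rewrite divfK ?subrr // gt_eqF.
by rewrite subr_eq0 => /eqP ->; rewrite mulfK // gt_eqF.
Qed.
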